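(* Let $\lambda$ be a frequency and $1\le p\le\infty$. The basis $\mathcal B=\{e^{-\lambda_n s}\}$ in $\mathcal H_p^\lambda$ is suppression unconditional for constant coefficients (SUCC) if and only if it is super-democratic. In addition, when this holds we have $$\varphi_{l,\mathcal E}^{p,\lambda}(N)\approx N^{1/2}\approx\varphi_{u,\mathcal E}^{p,\lambda}(N)\quad\text{if }1\le p<\infty,$$ or $$\varphi_{l,\mathcal E}^{\infty,\lambda}(N)\approx N=\varphi_{u,\mathcal E}^{\infty,\lambda}(N)\quad\text{if }p=\infty.$$
   Context: A frequency is a strictly increasing unbounded sequence $\lambda=(\lambda_n)_{n\ge1}$ of non-negative real numbers. A $\lambda$-Dirichlet polynomial is a finite sum $D=\sum_{n\in A}a_n e^{-\lambda_n s}$, with $A\subset\mathbb N$ finite and $a_n\in\mathbb C$. Its norms are $\|D\|_{\mathcal H_p^\lambda}=\lim_{R\to\infty}\big(\frac1{2R}\int_{-R}^R|\sum_{n\in A}a_n e^{-\lambda_n it}|^p\,dt\big)^{1/p}$ for $1\le p<\infty$ and $\|D\|_{\mathcal H_\infty^\lambda}=\sup_{t\in\mathbb R}|\sum_{n\in A}a_n e^{-i\lambda_n t}|$. For $1\le p<\infty$, $\mathcal H_p^\lambda$ is the completion of the space of $\lambda$-Dirichlet polynomials under $\|\cdot\|_{\mathcal H_p^\lambda}$; for $p=\infty$, $\mathcal B$ is regarded as a basis of the completion $\mathcal A_\infty^\lambda$ of the $\lambda$-Dirichlet polynomials under $\|\cdot\|_{\mathcal H_\infty^\lambda}$. For a finite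 set $A\subset\mathbb N$ let $\mathcal E_A$ be the set of families $\varepsilon=(\varepsilon_n)_{n\in A}$ of complex numbers with $|\varepsilon_n|=1$, and for $\varepsilon\in\mathcal E_A$ put $\mathbf 1_{\varepsilon,A}=\sum_{n\in A}\varepsilon_n e^{-\lambda_n s}$. All norms below are $\|\cdot\|_{\mathcal H_p^\lambda}$. $\mathcal B$ is super-democratic if there is $C>0$ such that $\|\mathbf 1_{\varepsilon,A}\|\le C\|\mathbf 1_{\tilde\varepsilon,B}\|$ for all finite sets $A,B\subset\mathbb N$ with $|A|\le|B|$ and all $\varepsilon\in\mathcal E_A$, $\tilde\varepsilon\in\mathcal E_B$. $\mathcal B$ is SUCC if there is $C>0$ such that $\|\mathbf 1_{\varepsilon,A}\|\le C\|\mathbf 1_{\tilde\varepsilon,B}\|$ for all finite sets $A\subset B\subset\mathbb N$ and all $\varepsilon\in\mathcal E_A$, $\tilde\varepsilon\in\mathcal E_B$. For $N\in\mathbb N$, with $A$ ranging over finite subsets of $\mathbb N$: $\varphi_{u,\mathcal E}^{p,\lambda}(N)=\sup\{\|\mathbf 1_{\varepsilon,A}\|:|A|\le N,\ \varepsilon\in\mathcal E_A\}$ and $\varphi_{l,\mathcal E}^{p,\lambda}(N)=\inf\{\|\mathbf 1_{\varepsilon,A}\|:|A|\ge N,\ \varepsilon\in\mathcal E_A\}$. $f(N)\approx g(N)$ means that there are constants $c,C>0$ independent of $N$ with $c\,g(N)\le f(N)\le C\,g(N)$ for all $N\in\mathbb N$. *)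

(* Defs.v *)
From HB Require Import structures.
From mathcomp Require Export all_boot all_order all_algebra finmap complex.
From mathcomp Require Export all_classical all_reals all_analysis.
Export Order.TTheory GRing.Theory Num.Theory.
Export numFieldNormedType.Exports.

Set Implicit Arguments.
Unset Strict Implicit.
Unset Printing Implicit Defensive.

Local Open Scope classical_set_scope.
Local Open Scope complex_scope.
Local Open Scope ring_scope.

(* Frequencies are indexed from 0: [lam n] is lambda_{n+1}. *)
Definition frequency (R : realType) (lam : nat -> R) : Prop :=
  [/\ forall n, 0 <= lam n, increasing_seq lam & ~ has_ubound (range lam)].

Definition cexp (R : realType) (z : R[i]) : R[i] :=
  (expR (complex.Re z))%:C * (cos (complex.Im z) +i* sin (complex.Im z)).

Definition modulus (R : realType) (z : R[i]) : R := ComplexField.Normc.normc z.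

(* Only the values of [a] on [A] matter, so a family of coefficients indexed by
   [A] is represented by a function on all of [nat]. *)
Definition dirichlet_poly (R : realType) (lam : nat -> R) (A : {fset nat})
    (a : nat -> R[i]) (s : R[i]) : R[i] :=
  \sum_(n <- A) a n * cexp (- (lam n)%:C * s).

(* The norm of H_p^lambda, 1 <= p <= +oo, computed from the values of a
   Dirichlet polynomial on the imaginary axis; the value at -oo is junk. *)
Definition Hnorm (R : realType) (p : \bar R) (D : R[i] -> R[i]) : R :=
  match p with
  | EFin q =>
      lim (((2 * T)^-1 *
            \int[lebesgue_measure]_(t in `[- T, T])
              (modulus (D ('i * t%:C)) `^ q)) `^ q^-1 @[T --> +oo])
  | +oo%E => sup (range (fun t : R => modulus (D ('i * t%:C))))
  | -oo%E => 0
  end.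

Definition unimodular (R : realType) (A : {fset nat}) (eps : nat -> R[i]) : Prop :=
  forall n, n \in A -> modulus (eps n) = 1.

(* || 1_{eps, A} || in H_p^lambda *)
Definition ind_norm (R : realType) (p : \bar R) (lam : nat -> R)
    (eps : nat -> R[i]) (A : {fset nat}) : R :=
  Hnorm p (dirichlet_poly lam A eps).

Definition super_democratic (R : realType) (p : \bar R) (lam : nat -> R) : Prop :=
  exists2 C : R, 0 < C &
    forall (A B : {fset nat}) (eps eps' : nat -> R[i]),
      (#|` A| <= #|` B|)%N -> unimodular A eps -> unimodular B eps' ->
      ind_norm p lam eps A <= C * ind_norm p lam eps' B.

Definition SUCC (R : realType) (p : \bar R) (lam : nat -> R) : Prop :=
  exists2 C : R, 0 < C &
    forall (A B : {fset nat}) (eps eps' : nat -> R[i]),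
      (A `<=` B)%fset -> unimodular A eps -> unimodular B eps' ->
      ind_norm p lam eps A <= C * ind_norm p lam eps' B.

Definition phi_u (R : realType) (p : \bar R) (lam : nat -> R) (N : nat) : R :=
  sup [set x | exists (A : {fset nat}) (eps : nat -> R[i]),
    [/\ (#|` A| <= N)%N, unimodular A eps & x = ind_norm p lam eps A]].

Definition phi_l (R : realType) (p : \bar R) (lam : nat -> R) (N : nat) : R :=
  inf [set x | exists (A : {fset nat}) (eps : nat -> R[i]),
    [/\ (N <= #|` A|)%N, unimodular A eps & x = ind_norm p lam eps A]].

Definition approx (R : realType) (f g : nat -> R) : Prop :=
  exists c C : R, [/\ 0 < c, 0 < C &
    forall N : nat, (0 < N)%N -> c * g N <= f N /\ f N <= C * g N].

(* Main.v *)
From mathcomp Require Import ring lra.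
Require Import Defs.

Set Implicit Arguments.
Unset Strict Implicit.
Unset Printing Implicit Defensive.

Local Open Scope classical_set_scope.
Local Open Scope ring_scope.

(** Super-democracy trivially implies SUCC, because [A `<=` B] gives
    [#|A| <= #|B|].  Everything else follows from two-sided bounds
    [c * g #|A| <= ||1_{eps,A}|| <= C * g #|A|], valid under SUCC for all
    finite [A] and all unimodular [eps], where [g N] is [sqrt N] for finite
    [p] and [N] for [p = +oo] ([bounds_super_democratic], [bounds_phi_l],
    [bounds_phi_u]).

    SUCC with [A = B] says that all choices of [eps] on a given [A] yield
    comparable norms, so it suffices to know one of them, or an average of
    them.  For [p = +oo] the choice [eps = 1] has norm exactly [#|A|],
    attained at [t = 0].  For finite [p = q] one averages [||1_{eps,A}||^q]
    over the [2^#|A|] choices of signs ([khinchine_dirichlet]): at each fixed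
    [t] the sum is a Rademacher sum of unimodular numbers, whose [q]-th moment
    is of order [#|A|^(q/2)] by Khinchine's inequality ([khinchine]), and this
    survives averaging over [t].

    Khinchine's inequality is obtained from two computations on the sign cube:
    the second moment is exactly the sum of squares, and the exponential moment
    factorizes over the coordinates, so that every power has a bounded normalized
    moment.  The lower bound follows from the second moment once the fourth one
    is bounded.

    The norm is defined by a limit, and exchanging it with the finite sum over
    signs requires that the limit exists.  Trigonometric polynomials have mean
    values by explicit integration, they form an algebra, and [|f|^2] is one of
    them when [f] is a Dirichlet polynomial on the imaginary axis.  Since
    [|f|^q = phi (|f|^2)] with [phi] continuous on a compact interval,
    Weierstrass approximation makes [|f|^q] a uniform limit of trigonometric
    polynomials ([trig_poly_comp_mean]), and having a mean value is stable under
    uniform limits ([has_mean_unif]). *)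

(** * Weierstrass approximation by Bernstein operators *)

(** The Bernstein polynomial of degree [n] evaluated at [x], that is, the
    expectation of [g] at a binomial variable with parameters [n] and [x],
    computed by conditioning on the first trial.  This recursion replaces all
    binomial identities by one-line inductions, and exhibits the value as a
    polynomial in [x]. *)
Fixpoint bernstein (R : realType) (n : nat) (x : R) (g : nat -> R) : R :=
  if n is m.+1 then x * bernstein m x (fun k => g k.+1) + (1 - x) * bernstein m x g
  else g 0%N.

Lemma le_bernstein (R : realType) (n : nat) (x : R) (g h : nat -> R) :
  0 <= x <= 1 -> (forall k, (k <= n)%N -> g k <= h k) ->
  bernstein n x g <= bernstein n x h.
Proof.
move=> /andP[x0 x1]; elim: n g h => [|n IH] g h gh /=; first exact: gh.
by rewrite lerD// ler_wpM2l ?subr_ge0// IH// => k kn; apply: gh => //; exact: ltnW.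
Qed.

Lemma bernstein_affine (R : realType) (n : nat) (x a b : R) (g : nat -> R) :
  bernstein n x (fun k => a + b * g k) = a + b * bernstein n x g.
Proof. by elim: n g => [|n IH] g //=; rewrite !IH; ring. Qed.

(** Variance [n x (1 - x)] plus squared bias: the spread of a binomial
    variable, which is all that the approximation theorem needs. *)
Lemma bernstein_var (R : realType) (n : nat) (x c : R) :
  bernstein n x (fun k => (k%:R - c) ^+ 2) = n%:R * (x * (1 - x)) + (n%:R * x - c) ^+ 2.
Proof.
elim: n c => [|n IH] c /=; first by ring.
transitivity (x * bernstein n x (fun k => (k%:R - (c - 1)) ^+ 2)
    + (1 - x) * bernstein n x (fun k => (k%:R - c) ^+ 2)).
  congr (x * _ + _); congr (bernstein n x _); apply/funext => k.
  by rewrite -natr1; ring.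
by rewrite !IH -natr1; ring.
Qed.

(** Uniform continuity in the form suited to a variance estimate: points that
    are close contribute at most [e], and for points at distance at least some
    [d > 0] the bound [2 sup |phi|] is absorbed by [K * (x - y)^2].  The
    compactness of the segment makes [K] uniform. *)
Lemma continuous_quadratic_modulus (R : realType) (phi : R -> R) (e : R) :
  continuous phi -> 0 < e ->
  exists2 K : R, 0 <= K & forall x y, 0 <= x <= 1 -> 0 <= y <= 1 ->
    `|phi x - phi y| <= e + K * (x - y) ^+ 2.
Proof.
move=> cphi e0.
have cp : compact (`[0, 1] : set R) by exact: segment_compact.
have cw : {within `[0, 1], continuous phi} by exact: continuous_subspaceT.
have [M [_ MP]] : bounded_set (phi @` `[0, 1]).
  by apply: compact_bounded; exact: continuous_compact.
pose B := `|M| + 1.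
have phiB y : 0 <= y <= 1 -> `|phi y| <= B.
  move=> y01; apply: MP; first by rewrite /B ltr_pwDr// ler_norm.
  by exists y => //=; rewrite in_itv.
have B0 : 0 <= B by rewrite /B addr_ge0.
have : \forall K \near +oo, `[0, 1]%classic `<=`
    (fun x => forall y, 0 <= y <= 1 -> `|phi x - phi y| <= e + K * (x - y) ^+ 2).
  move/compact_near_coveringP/near_covering_withinP in cp; apply: cp => x x01.
  have /cvgrPdist_lt/(_ (e / 2)) := cphi x; rewrite divr_gt0// => /(_ isT).
  move=> [d /= d0 dP].
  (* Halving the radius keeps x' and y apart when x and y are d apart. *)
  exists (ball x (d / 2), [set K | B * 2 * (2 / d) ^+ 2 <= K]); first split => /=.
  - by apply: nbhsx_ballx; rewrite divr_gt0.
  - by apply: nbhs_pinfty_ge; exact: num_real.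
  - move=> [x' K] [/= xx' KB] x'01 y y01.
    have d2 : `|x - x'| < d / 2 by [].
    have [xy|xy] := ltP `|x - y| d.
      have h1 := dP y xy; have h2 : `|phi x - phi x'| < e / 2.
        by apply: dP => /=; apply: lt_trans d2 _; rewrite ltr_pdivrMr// ltr_pMr// ltr1n.
      have K0 : 0 <= K.
        by apply: le_trans KB; apply: mulr_ge0; [exact: mulr_ge0|exact: sqr_ge0].
      apply: ler_wpDr; first by rewrite mulr_ge0// sqr_ge0.
      rewrite -(subrKA (phi x)); apply: le_trans (ler_normD _ _) _.
      by rewrite [leRHS]splitr lerD// ltW// distrC.
    have x'y : d / 2 <= `|x' - y|.
      have := ler_distD x' x y; move: xy d2; lra.
    have yB := phiB _ y01; have x'B : `|phi x'| <= B.
      by apply: phiB; move: x'01; rewrite in_itv.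
    apply: (@le_trans _ _ (B * 2)).
      by apply: le_trans (ler_normB _ _) _; rewrite mulr_natr mulr2n lerD.
    apply: ler_wpDl; first exact: ltW.
    apply: (@le_trans _ _ (B * 2 * (2 / d) ^+ 2 * (x' - y) ^+ 2)); last first.
      by rewrite ler_wpM2r// sqr_ge0.
    rewrite -mulrA ler_peMr ?mulr_ge0// -exprMn -real_normK ?num_real// normrM.
    rewrite exprn_ege1// ger0_norm ?divr_ge0 ?(ltW d0)// -(@ler_pM2l _ (d / 2)) ?divr_gt0//.
    by rewrite mulr1 mulrA [X in _ <= X * _](_ : _ = 1) ?mul1r//; field; rewrite gt_eqF.
move=> [K0 [_ KP]]; exists (`|K0| + 1); first by rewrite addr_ge0.
move=> x y x01; apply: KP; last by rewrite /= in_itv.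
by rewrite ltr_pwDr// ler_norm.
Qed.

(** Apply the positive operator to [|phi (k/n) - phi x| <= e/2 + K (k/n - x)^2]:
    the variance of [k/n] is at most [1/n], so the second term is small for
    large [n]. *)
Lemma bernstein_approx (R : realType) (phi : R -> R) (e : R) :
  continuous phi -> 0 < e ->
  exists n, forall x, 0 <= x <= 1 ->
    `|bernstein n x (fun k => phi (k%:R / n%:R)) - phi x| <= e.
Proof.
move=> cphi e0; have e20 : 0 < e / 2 by rewrite divr_gt0.
have [K K0 KP] := continuous_quadratic_modulus cphi e20.
pose n := (Num.trunc (K / (e / 2))).+1.
have n0 : 0 < n%:R :> R by rewrite ltr0n.
have Kn : K / n%:R <= e / 2.
  by rewrite ler_pdivrMr// mulrC -ler_pdivrMr// ltW// truncnS_gt.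
exists n => x x01.
pose h k := e / 2 + K / n%:R ^+ 2 * (k%:R - n%:R * x) ^+ 2.
have hP : bernstein n x h <= e.
  rewrite /h bernstein_affine bernstein_var subrr expr0n addr0 [leRHS]splitr lerD2l.
  apply: le_trans Kn.
  have -> : K / n%:R ^+ 2 * (n%:R * (x * (1 - x))) = K / n%:R * (x * (1 - x)).
    by field; rewrite gt_eqF.
  move/andP: x01 => [x0 x1]; rewrite ler_piMr ?divr_ge0 ?(ltW n0)//.
  by rewrite mulr_ile1 ?subr_ge0// lerBlDr lerDl.
have phih k : (k <= n)%N -> `|phi (k%:R / n%:R) - phi x| <= h k.
  move=> kn; apply: le_trans (KP _ _ _ x01) _.
    by rewrite divr_ge0 ?ler0n//= ler_pdivrMr// mul1r ler_nat.
  rewrite /h lerD2l -mulrA ler_wpM2l// mulrC le_eqVlt; apply/orP; left.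
  by apply/eqP; field; rewrite gt_eqF.
rewrite ler_distl; apply/andP; split.
  apply: (@le_trans _ _ (phi x + -1 * bernstein n x h)).
    by rewrite mulN1r lerD2l lerN2.
  rewrite -bernstein_affine; apply: le_bernstein => // k /phih.
  by rewrite mulN1r ler_distl => /andP[].
apply: (@le_trans _ _ (phi x + 1 * bernstein n x h)); last by rewrite mul1r lerD2l.
rewrite -bernstein_affine; apply: le_bernstein => // k /phih.
by rewrite mul1r ler_distl => /andP[].
Qed.

(** * Mean values of trigonometric polynomials *)

Definition window_mean (R : realType) (g : R -> R) (T : R) : R :=
  (2 * T)^-1 * \int[lebesgue_measure]_(t in `[- T, T]) g t.

(** Continuity is part of the notion because it makes the window integrals
    additive and monotone. *)
Definition has_mean (R : realType) (g : R -> R) : Prop :=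
  continuous g /\ cvg (window_mean g T @[T --> +oo]).

Definition mean (R : realType) (g : R -> R) : R := lim (window_mean g T @[T --> +oo]).

Lemma continuous_integrable_itv (R : realType) (g : R -> R) (a b : R) :
  continuous g -> lebesgue_measure.-integrable `[a, b] (EFin \o g).
Proof.
move=> cg; apply: continuous_compact_integrable; first exact: segment_compact.
exact: continuous_subspaceT.
Qed.

Lemma window_meanD (R : realType) (g h : R -> R) (T : R) :
  continuous g -> continuous h ->
  window_mean (fun t => g t + h t) T = window_mean g T + window_mean h T.
Proof.
move=> cg ch; rewrite /window_mean RintegralD ?mulrDr//;
  exact: continuous_integrable_itv.
Qed.

Lemma window_meanZ (R : realType) (c : R) (g : R -> R) (T : R) :
  continuous g -> window_mean (fun t => c * g t) T = c * window_mean g T.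
Proof.
move=> cg; rewrite /window_mean RintegralZl//; last exact: continuous_integrable_itv.
by rewrite mulrCA.
Qed.

Lemma window_mean_cst (R : realType) (c T : R) : 0 < T ->
  window_mean (fun=> c) T = c.
Proof.
move=> T0; rewrite /window_mean Rintegral_cst//.
have L := lebesgue_measure_itv `[- T, T].
rewrite [X in fine X](_ : _ = (2 * T)%:E); first by rewrite /=; field; rewrite gt_eqF.
apply: etrans L _; rewrite /= lte_fin ifT; last by lra.
by rewrite -EFinB; congr EFin; lra.
Qed.

Lemma le_window_mean (R : realType) (g h : R -> R) (T : R) : 0 < T ->
  continuous g -> continuous h -> (forall t, g t <= h t) ->
  window_mean g T <= window_mean h T.
Proof.
move=> T0 cg ch gh; rewrite ler_wpM2l ?invr_ge0 ?mulr_ge0 ?(ltW T0)//.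
by apply: le_Rintegral => //; exact: continuous_integrable_itv.
Qed.

Lemma has_meanD (R : realType) (g h : R -> R) : has_mean g -> has_mean h ->
  has_mean (fun t => g t + h t).
Proof.
move=> [cg mg] [ch mh]; split; first by move=> t; apply: cvgD; [exact: cg|exact: ch].
have -> : window_mean (fun t => g t + h t) = window_mean g \+ window_mean h.
  by apply/funext => T; rewrite window_meanD.
exact: is_cvgD mg mh.
Qed.

Lemma meanD (R : realType) (g h : R -> R) : has_mean g -> has_mean h ->
  mean (fun t => g t + h t) = mean g + mean h.
Proof.
move=> [cg mg] [ch mh]; rewrite /mean.
have -> : window_mean (fun t => g t + h t) = window_mean g \+ window_mean h.
  by apply/funext => T; rewrite window_meanD.
exact: limD mg mh.
Qed.

Lemma has_meanZ (R : realType) (c : R) (g : R -> R) : has_mean g ->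
  has_mean (fun t => c * g t).
Proof.
move=> [cg mg]; split; first by move=> t; apply: cvgM; [exact: cvg_cst|exact: cg].
have -> : window_mean (fun t => c * g t) = fun T => c * window_mean g T.
  by apply/funext => T; rewrite window_meanZ.
by apply: is_cvgM => //; exact: is_cvg_cst.
Qed.

Lemma cvg_mean_cst (R : realType) (c : R) :
  window_mean (fun=> c) T @[T --> +oo] --> c.
Proof.
apply: cvg_near_cst; near=> T.
have T0 : 0 < T by near: T; apply: nbhs_pinfty_gt; exact: num_real.
exact: window_mean_cst.
Unshelve. all: by end_near. Qed.

Lemma has_mean_cst (R : realType) (c : R) : has_mean (fun=> c : R).
Proof.
split; first by move=> t; exact: cvg_cst.
by apply/cvg_ex; exists c; exact: cvg_mean_cst.
Qed.

Lemma mean_cst (R : realType) (c : R) : mean (fun=> c) = c.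
Proof. by apply/cvg_lim => //; exact: cvg_mean_cst. Qed.

Lemma le_mean (R : realType) (g h : R -> R) : has_mean g -> has_mean h ->
  (forall t, g t <= h t) -> mean g <= mean h.
Proof.
move=> [cg mg] [ch mh] gh; apply: (ler_lim mg mh); near=> T.
have T0 : 0 < T by near: T; apply: nbhs_pinfty_gt; exact: num_real.
exact: le_window_mean.
Unshelve. all: by end_near. Qed.

Lemma has_mean_sum (R : realType) (I : finType) (g : I -> R -> R) :
  (forall i, has_mean (g i)) -> has_mean (fun t => \sum_i g i t).
Proof.
move=> mg; elim: (index_enum I) => [|i s IH].
  under eq_fun do rewrite big_nil; exact: has_mean_cst.
under eq_fun do rewrite big_cons; exact: has_meanD (mg i) IH.
Qed.

Lemma mean_sum (R : realType) (I : finType) (g : I -> R -> R) :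
  (forall i, has_mean (g i)) -> mean (fun t => \sum_i g i t) = \sum_i mean (g i).
Proof.
move=> mg.
suff : has_mean (fun t => \sum_i g i t) /\
    mean (fun t => \sum_i g i t) = \sum_i mean (g i) by case.
elim: (index_enum I) => [|i s [IH1 IH2]].
  rewrite big_nil; under eq_fun do rewrite big_nil.
  by rewrite mean_cst; split => //; exact: has_mean_cst.
rewrite big_cons; under eq_fun do rewrite big_cons.
by split; [exact: has_meanD (mg i) IH1|rewrite (meanD (mg i) IH1) IH2].
Qed.

(** The window means of [g] and of a uniform [e]-approximation differ by at most
    [e], so the window means of [g] satisfy the Cauchy criterion at infinity. *)
Lemma has_mean_unif (R : realType) (g : R -> R) : continuous g ->
  (forall e : R, 0 < e -> exists2 h, has_mean h & forall t, `|h t - g t| <= e) ->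
  has_mean g.
Proof.
move=> cg gP; split => //.
apply/cauchy_cvgP; apply: cauchy_exP => e e0.
have e20 : 0 < e / 2 by rewrite divr_gt0.
have [h [ch mh] hg] := gP _ e20.
exists (mean h); rewrite /nbhs/=.
have /cvgrPdist_lt/(_ _ e20) mh' : window_mean h T @[T --> +oo] --> mean h by [].
near=> T.
have T0 : 0 < T by near: T; apply: nbhs_pinfty_gt; exact: num_real.
rewrite /ball/= -(subrKA (window_mean h T)) [ltRHS]splitr.
apply: le_lt_trans (ler_normD _ _) _; apply: ltr_leD; first by near: T.
have E1 : window_mean g T <= window_mean h T + e / 2.
  rewrite -[X in _ + X](window_mean_cst _ T0) -window_meanD//; last exact: cst_continuous.
  apply: le_window_mean => //.
    by move=> t; apply: cvgD; [exact: ch|exact: cvg_cst].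
  by move=> t; have := hg t; rewrite ler_distl; lra.
have E2 : window_mean h T <= window_mean g T + e / 2.
  rewrite -[X in _ + X](window_mean_cst _ T0) -window_meanD//; last exact: cst_continuous.
  apply: le_window_mean => //.
    by move=> t; apply: cvgD; [exact: cg|exact: cvg_cst].
  by move=> t; have := hg t; rewrite ler_distl; lra.
by rewrite ler_distl; lra.
Unshelve. all: by end_near. Qed.

Lemma continuous_cos_affine (R : realType) (mu th : R) :
  continuous (fun t : R => cos (mu * t + th)).
Proof.
move=> t; apply: (@continuous_comp _ _ _ (fun t => mu * t + th) (@cos R));
  last exact: continuous_cos.
by apply: cvgD; [apply: cvgM => //; exact: cvg_cst|exact: cvg_cst].
Qed.

(** The primitive [sin (mu t + th) / mu] is bounded, hence dividing its
    increment by the length of the window gives mean [0] unless [mu = 0]. *)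
Lemma has_mean_cos (R : realType) (mu th : R) :
  has_mean (fun t : R => cos (mu * t + th)).
Proof.
have [->|mu0] := eqVneq mu 0.
  under eq_fun do rewrite mul0r; exact: has_mean_cst.
split; first exact: continuous_cos_affine.
pose F t := mu^-1 * sin (mu * t + th).
have dF t : is_derive t (1:R) F (cos (mu * t + th)).
  apply: is_derive_eq.
  by rewrite /GRing.scale/= !(mulr0,addr0,mulr1,mul1r,add0r); field.
apply/cvg_ex; exists 0; apply/cvgrPdist_le => e e0; near=> T.
have T0 : 0 < T by near: T; apply: nbhs_pinfty_gt; exact: num_real.
have : (e * `|mu|)^-1 <= T by near: T; apply: nbhs_pinfty_ge; exact: num_real.
rewrite invfM ler_pdivrMl// => Te.
rewrite /window_mean /Rintegral.
rewrite (@continuous_FTC2 _ _ F); last first.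
- by move=> t _; rewrite derive1E; exact: derive_val.
- have cF t : {for t, continuous F}.
    by apply: differentiable_continuous; apply/derivable1_diffP; apply: ex_derive.
  split.
  + by move=> t _; exact: ex_derive.
  + by apply: cvg_at_right_filter; exact: cF.
  + by apply: cvg_at_left_filter; exact: cF.
- by apply: continuous_subspaceT; exact: continuous_cos_affine.
- by lra.
rewrite -EFinB/= sub0r normrN normrM /F -mulrBr normrM.
have s2 : `|sin (mu * T + th) - sin (mu * - T + th)| <= 2.
  rewrite ler_distl; have := sin_le1 (mu * T + th); have := sin_le1 (mu * - T + th).
  by have := sin_geN1 (mu * T + th); have := sin_geN1 (mu * - T + th); lra.
rewrite normfV [X in _ * (X * _)]normfV (gtr0_norm (_ : 0 < 2 * T)); last by lra.
rewrite ler_pdivrMl; last by lra.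
apply: le_trans (ler_pM _ _ Te s2) _; rewrite ?invr_ge0//.
by rewrite le_eqVlt; apply/orP; left; apply/eqP; ring.
Unshelve. all: by end_near. Qed.

(** Real trigonometric polynomials with arbitrary real frequencies; the phases
    [th] make sines unnecessary as generators. *)
Inductive trig_poly (R : realType) : (R -> R) -> Prop :=
| trig_poly0 : trig_poly (fun=> 0)
| trig_polyS c mu th g : trig_poly g ->
    trig_poly (fun t => c * cos (mu * t + th) + g t).

Lemma trig_poly_mean (R : realType) (g : R -> R) : trig_poly g -> has_mean g.
Proof.
elim=> [|c mu th h _ mh]; first exact: has_mean_cst.
exact: has_meanD (has_meanZ c (has_mean_cos mu th)) mh.
Qed.

Lemma trig_polyD (R : realType) (g h : R -> R) : trig_poly g -> trig_poly h ->
  trig_poly (fun t => g t + h t).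
Proof.
move=> tg th; elim: tg => [|c mu a k _ IH]; first by under eq_fun do rewrite add0r.
by under eq_fun do rewrite -addrA; exact: trig_polyS.
Qed.

Lemma trig_poly_cos (R : realType) (c mu th : R) : trig_poly (fun t => c * cos (mu * t + th)).
Proof.
by have := trig_polyS c mu th (trig_poly0 R); under eq_fun do rewrite addr0.
Qed.

Lemma trig_poly_cst (R : realType) (c : R) : trig_poly (fun=> c : R).
Proof.
have := trig_poly_cos c 0 0; congr trig_poly; apply/funext => t.
by rewrite mul0r addr0 cos0 mulr1.
Qed.

(** The product of two cosines is a half-sum of cosines of the sum and the
    difference of the arguments. *)
Lemma trig_polyM (R : realType) (g h : R -> R) : trig_poly g -> trig_poly h ->
  trig_poly (fun t => g t * h t).
Proof.
move=> tg th; elim: tg => [|c mu a k _ IH].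
  by under eq_fun do rewrite mul0r; exact: trig_poly0.
under eq_fun do rewrite mulrDl; apply: trig_polyD => {IH} //.
elim: th => [|d nu b l _ IH]; first by under eq_fun do rewrite mulr0; exact: trig_poly0.
under eq_fun do rewrite mulrDr; apply: trig_polyD => //.
have := trig_polyD (trig_poly_cos (c * d / 2) (mu + nu) (a + b))
  (trig_poly_cos (c * d / 2) (mu - nu) (a - b)).
congr trig_poly; apply/funext => t.
have -> : (mu + nu) * t + (a + b) = (mu * t + a) + (nu * t + b) by ring.
have -> : (mu - nu) * t + (a - b) = (mu * t + a) - (nu * t + b) by ring.
by rewrite cosB cosD; field.
Qed.

Lemma trig_poly_bernstein (R : realType) (n : nat) (u : R -> R) (g : nat -> R) :
  trig_poly u -> trig_poly (fun t => bernstein n (u t) g).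
Proof.
move=> tu; elim: n g => [|n IH] g /=; first exact: trig_poly_cst.
apply: trig_polyD; apply: trig_polyM => //.
apply: trig_polyD; first exact: trig_poly_cst.
by under eq_fun do rewrite -mulN1r; apply: trig_polyM => //; exact: trig_poly_cst.
Qed.

(** The key to the existence of the limits defining the norms: Bernstein
    polynomials of [u] are trigonometric polynomials converging uniformly to
    [phi \o u]. *)
Lemma trig_poly_comp_mean (R : realType) (phi u : R -> R) :
  trig_poly u -> (forall t, 0 <= u t <= 1) -> continuous phi ->
  has_mean (fun t => phi (u t)).
Proof.
move=> tu u01 cphi; have [cu _] := trig_poly_mean tu.
apply: has_mean_unif => [t|e e0].
  by apply: (@continuous_comp _ _ _ u phi); [exact: cu|exact: cphi].
have [n nP] := bernstein_approx cphi e0.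
exists (fun t => bernstein n (u t) (fun k => phi (k%:R / n%:R))) => [|t]; last exact: nP.
by apply: trig_poly_mean; exact: trig_poly_bernstein.
Qed.

(** * Khinchine's inequality *)

Definition signed_sum (R : realType) (I : finType) (x : I -> R) (s : {ffun I -> bool}) : R :=
  \sum_i (-1) ^+ s i * x i.

Lemma sum_signs_prod (R : realType) (I : finType) (F : I -> bool -> R) :
  \sum_(s : {ffun I -> bool}) \prod_i F i (s i) = \prod_i (F i true + F i false).
Proof. by rewrite -bigA_distr_bigA; apply: eq_bigr => i _; rewrite big_bool. Qed.

(** Orthogonality of the Rademacher functions. *)
Lemma sum_signs_mul (R : realType) (I : finType) (i j : I) :
  \sum_(s : {ffun I -> bool}) (-1) ^+ s i * (-1) ^+ s j
    = (2 ^+ #|I|) *+ (i == j) :> R.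
Proof.
have [<-|ij] := eqVneq i j.
  rewrite (eq_bigr (fun=> 1)) => [|s _]; last by rewrite -signr_addb addbb.
  by rewrite sumr_const card_ffun card_bool natrX.
(* Write the summand as a product over all coordinates; the one at [i] sums to 0. *)
pose F k (b : bool) : R := (if k == i then (-1) ^+ b else 1) * (if k == j then (-1) ^+ b else 1).
rewrite (eq_bigr (fun s : {ffun I -> bool} => \prod_k F k (s k))) => [|s _].
  rewrite sum_signs_prod (bigD1 i)//= /F eqxx (negbTE ij) expr1 expr0 !mulr1 addNr mul0r.
  by rewrite mulr0n.
by rewrite big_split/= -!big_mkcond/= !big_pred1_eq.
Qed.

Lemma signed_sum_sqr (R : realType) (I : finType) (x : I -> R) :
  \sum_s signed_sum x s ^+ 2 = 2 ^+ #|I| * \sum_i x i ^+ 2.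
Proof.
transitivity (\sum_i \sum_j \sum_(s : {ffun I -> bool})
   ((-1) ^+ s i * (-1) ^+ s j) * (x i * x j)).
  rewrite (eq_bigr (fun s : {ffun I -> bool} =>
    \sum_i \sum_j ((-1) ^+ s i * (-1) ^+ s j) * (x i * x j))) => [|s _].
    by rewrite exchange_big; apply: eq_bigr => i _; rewrite exchange_big.
  rewrite expr2 /signed_sum big_distrlr; apply: eq_bigr => i _; apply: eq_bigr => j _.
  by rewrite mulrACA.
rewrite mulr_sumr; apply: eq_bigr => i _.
rewrite (bigD1 i)//= [X in _ + X]big1 => [|j ji]; rewrite -mulr_suml sum_signs_mul.
  by rewrite eqxx mulr1n addr0 -expr2.
by rewrite eq_sym (negbTE ji) mulr0n mul0r.
Qed.

(** A form of [cosh x <= exp (x^2 / 2)] with a worse constant, for small [x]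
    only, which follows from [1 + x <= exp x] alone. *)
Lemma expRD_expRN_le (R : realType) (x : R) : `|x| <= 2^-1 ->
  expR x + expR (- x) <= 2 * expR (2 * x ^+ 2).
Proof.
move=> x2.
(* Invert [1 - y <= exp (- y)]. *)
have H (y : R) : `|y| <= 2^-1 -> expR y <= 1 + y + 2 * y ^+ 2.
  rewrite ler_norml => /andP[y1 y2].
  have y3 : 0 < 1 - y by lra.
  rewrite -[expR y]invrK -expRN; apply: (@le_trans _ _ (1 - y)^-1).
    by rewrite lef_pV2 ?posrE ?expR_gt0//; exact: expR_ge1Dx.
  rewrite -[(1 - y)^-1]mul1r ler_pdivrMr//.
  have -> : (1 + y + 2 * y ^+ 2) * (1 - y) = 1 + y ^+ 2 * (1 - 2 * y) by ring.
  by rewrite lerDl mulr_ge0 ?sqr_ge0//; lra.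
have := H _ x2; have := H (- x); rewrite normrN sqrrN => /(_ x2).
have := expR_ge1Dx (2 * x ^+ 2); set E := expR (2 * _); lra.
Qed.

(** The normalized sum is subgaussian: its exponential moment factorizes over
    the coordinates, and dividing by [2 r] brings each coefficient within
    reach of [expRD_expRN_le]. *)
Lemma sum_expR_signed_sum (R : realType) (I : finType) (x : I -> R) (r : R) :
  0 < r -> \sum_i x i ^+ 2 <= r ^+ 2 ->
  \sum_s expR (signed_sum x s / (2 * r)) <= 2 ^+ #|I| * expR 2^-1.
Proof.
move=> r0 xr.
have xir i : `|x i| <= r.
  rewrite -ler_sqr ?nnegrE ?(ltW r0)// real_normK ?num_real//; apply: le_trans xr.
  by rewrite (bigD1 i)//= lerDl sumr_ge0// => j _; rewrite sqr_ge0.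
rewrite (eq_bigr (fun s : {ffun I -> bool} =>
  \prod_i expR ((-1) ^+ s i * x i / (2 * r)))); last first.
  by move=> s _; rewrite -expR_sum -mulr_suml.
rewrite (sum_signs_prod (fun i b => expR ((-1) ^+ b * x i / (2 * r)))).
apply: (@le_trans _ _ (\prod_i (2 * expR (2 * (x i / (2 * r)) ^+ 2)))).
  apply: ler_prod => i _; rewrite addr_ge0 ?expR_ge0//= expr1 expr0 mul1r mulN1r mulNr addrC.
  apply: expRD_expRN_le; rewrite normrM normfV (gtr0_norm (_ : 0 < 2 * r)); last by lra.
  rewrite ler_pdivrMr; last by lra.
  by rewrite mulrA mulVf ?mul1r.
rewrite big_split/= prodr_const -expR_sum ler_wpM2l ?exprn_ge0// ler_expR.
have -> : \sum_i 2 * (x i / (2 * r)) ^+ 2 = 2^-1 * ((\sum_i x i ^+ 2) / r ^+ 2).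
  rewrite mulr_suml mulr_sumr; apply: eq_bigr => i _; field; rewrite gt_eqF//.
by rewrite ler_piMr// ler_pdivrMr ?mul1r ?exprn_gt0.
Qed.

(** This is [z <= exp z] at [z = y / (4 q)], raised to the power [q]. *)
Lemma powR_le_expR (R : realType) (q y : R) : 0 < q -> 0 <= y ->
  y `^ q <= (4 * q) `^ q * expR (y / 4).
Proof.
move=> q0; rewrite le_eqVlt => /predU1P[<-|y0].
  by rewrite powR0 ?gt_eqF// mulr_ge0 ?powR_ge0 ?expR_ge0.
have q40 : 0 < 4 * q by lra.
have -> : y / 4 = (y / (4 * q)) * q by field; rewrite gt_eqF.
rewrite expRM -powRM ?expR_ge0 ?(ltW q40)//.
apply: ge0_ler_powR; rewrite ?nnegrE ?(ltW q0) ?(ltW y0)//.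
  by rewrite mulr_ge0 ?expR_ge0 ?ltW.
rewrite -ler_pdivrMl//; apply: le_trans (expR_ge1Dx _).
by rewrite [X in X <= _]mulrC lerDr.
Qed.

Lemma signed_sumN (R : realType) (I : finType) (x : I -> R) (s : {ffun I -> bool}) :
  signed_sum (fun i => - x i) s = - signed_sum x s.
Proof. by rewrite /signed_sum -sumrN; apply: eq_bigr => i _; rewrite mulrN. Qed.

(** Upper Khinchine bound for complex coefficients [x i + 'i * y i].  A power is
    dominated by an exponential, and the modulus is at most twice the larger
    of the absolute values of the real and imaginary parts, whose
    exponentials are controlled by [sum_expR_signed_sum]. *)
Lemma sum_powR_signed_norm_le (R : realType) (q : R) (I : finType) (x y : I -> R) (r : R) :
  0 < q -> 0 < r -> \sum_i (x i ^+ 2 + y i ^+ 2) = r ^+ 2 ->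
  \sum_s (Num.sqrt (signed_sum x s ^+ 2 + signed_sum y s ^+ 2) / r) `^ q
    <= 2 ^+ #|I| * ((4 * q) `^ q * (4 * expR 2^-1)).
Proof.
move=> q0 r0 xyr; pose m s := Num.sqrt (signed_sum x s ^+ 2 + signed_sum y s ^+ 2) / r.
rewrite -/(\sum_s m s `^ q).
have m0 s : 0 <= m s by rewrite divr_ge0 ?sqrtr_ge0 ?(ltW r0).
pose e (z : I -> R) s := expR (signed_sum z s / (2 * r)).
have xr : \sum_i x i ^+ 2 <= r ^+ 2.
  by rewrite -xyr ler_sum// => i _; rewrite lerDl sqr_ge0.
have yr : \sum_i y i ^+ 2 <= r ^+ 2.
  by rewrite -xyr ler_sum// => i _; rewrite lerDr sqr_ge0.
pose W s := (e x s + e (fun i => - x i) s) + (e y s + e (fun i => - y i) s).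
have WP : \sum_s W s <= 2 ^+ #|I| * (4 * expR 2^-1).
  rewrite !big_split/=.
  have N (z : I -> R) : \sum_i (- z i) ^+ 2 = \sum_i z i ^+ 2.
    by apply: eq_bigr => i _; rewrite sqrrN.
  have := sum_expR_signed_sum r0 xr; have := sum_expR_signed_sum r0 yr.
  have := @sum_expR_signed_sum _ _ (fun i => - x i) r r0; rewrite N => /(_ xr).
  have := @sum_expR_signed_sum _ _ (fun i => - y i) r r0; rewrite N => /(_ yr).
  rewrite /e; set P := 2 ^+ _ * expR _.
  have -> : 2 ^+ #|I| * (4 * expR 2^-1) = 4 * P by rewrite /P; ring.
  lra.
have eabs (z : I -> R) s : expR (`|signed_sum z s| / (2 * r)) <= e z s + e (fun i => - z i) s.
  rewrite /e signed_sumN; case: (ger0P (signed_sum z s)) => _.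
    by rewrite lerDl expR_ge0.
  by rewrite lerDr expR_ge0.
have mW s : expR (m s / 4) <= W s.
  have M1 : m s <= (`|signed_sum x s| + `|signed_sum y s|) / r.
    rewrite ler_pM2r ?invr_gt0// -[leRHS]ger0_norm ?addr_ge0// -sqrtr_sqr.
    apply: ler_wsqrtr; rewrite sqrrD !real_normK ?num_real// addrAC lerDl.
    by rewrite mulrn_wge0// mulr_ge0.
  have half a b : 0 <= a -> a <= b -> m s <= (a + b) / r -> m s / 4 <= b / (2 * r).
    move=> a0 ab h; have -> : b / (2 * r) = (b + b) / r / 4 by field; rewrite gt_eqF.
    rewrite ler_pM2r; last by lra.
    by apply: le_trans h _; rewrite ler_pM2r ?invr_gt0// lerD2r.
  have W1 := eabs x s; have W2 := eabs y s.
  have [xy|/ltW yx] := leP `|signed_sum x s| `|signed_sum y s|.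
    apply: (@le_trans _ _ (expR (`|signed_sum y s| / (2 * r)))).
      by rewrite ler_expR; apply: half xy M1.
    by apply: le_trans W2 _; rewrite lerDr addr_ge0 ?expR_ge0.
  apply: (@le_trans _ _ (expR (`|signed_sum x s| / (2 * r)))).
    by rewrite ler_expR; apply: half yx _ => //; rewrite addrC.
  by apply: le_trans W1 _; rewrite lerDl addr_ge0 ?expR_ge0.
rewrite mulrCA; apply: le_trans (ler_wpM2l (powR_ge0 _ _) WP).
rewrite mulr_sumr ler_sum// => s _; apply: le_trans (powR_le_expR q0 (m0 s)) _.
by rewrite ler_wpM2l ?powR_ge0.
Qed.

(** With [u] the modulus divided by [r], so that [u^2] has average [1], the
    lower bound averages the pointwise inequality
    [u^2 <= 1/4 + u^4 / B + B 2^q u^q]: the first term takes care of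
    [u <= 1/2], the second of [u^2 >= B], the third of the values in between.
    As [u^4] has average at most [B/4], what remains for the last term is at
    least [1/2]. *)
Lemma khinchine (R : realType) (q : R) : 0 < q ->
  exists k K : R, [/\ 0 < k, 0 < K &
    forall (I : finType) (x y : I -> R) (r : R),
      0 <= r -> \sum_i (x i ^+ 2 + y i ^+ 2) = r ^+ 2 ->
      2 ^+ #|I| * (k * r `^ q)
        <= \sum_s Num.sqrt (signed_sum x s ^+ 2 + signed_sum y s ^+ 2) `^ q
        <= 2 ^+ #|I| * (K * r `^ q)].
Proof.
move=> q0; pose B : R := 4 * ((4 * 4) `^ 4 * (4 * expR 2^-1)).
have B0 : 0 < B by rewrite !mulr_gt0 ?powR_gt0 ?expR_gt0.
have B2 : 0 < B * 2 `^ q by rewrite mulr_gt0 ?powR_gt0.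
exists (2 * (B * 2 `^ q))^-1, ((4 * q) `^ q * (4 * expR 2^-1)); split.
- by rewrite invr_gt0 mulr_gt0.
- by rewrite !mulr_gt0 ?powR_gt0 ?expR_gt0// mulr_gt0.
move=> I x y r; pose m s := Num.sqrt (signed_sum x s ^+ 2 + signed_sum y s ^+ 2).
rewrite -/(\sum_s m s `^ q).
have m0 s : 0 <= m s by exact: sqrtr_ge0.
have m2 : (\sum_i (x i ^+ 2 + y i ^+ 2)) * 2 ^+ #|I| = \sum_s m s ^+ 2.
  rewrite mulrC big_split/= mulrDr -!signed_sum_sqr -big_split; apply: eq_bigr => s _.
  by rewrite sqr_sqrtr// addr_ge0// sqr_ge0.
rewrite le_eqVlt => /predU1P[<-|r0] xyr.
  move: m2; rewrite xyr expr0n mul0r => m2.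
  have mE s : m s = 0.
    apply/eqP; rewrite -sqrf_eq0; apply/eqP.
    by apply: (psumr_eq0P _ (esym m2)) => // t _; exact: sqr_ge0.
  by under eq_bigr do rewrite mE powR0 ?gt_eqF//; rewrite big1// powR0 ?gt_eqF// !mulr0 lexx.
pose u s := m s / r; have u0 s : 0 <= u s by rewrite divr_ge0 ?(ltW r0).
have mu : \sum_s m s `^ q = \sum_s u s `^ q * r `^ q.
  by apply: eq_bigr => s _; rewrite -powRM ?(ltW r0)// /u divfK// gt_eqF.
rewrite mu -mulr_suml [X in X <= _ <= _]mulrA [X in _ <= _ <= X]mulrA.
rewrite !ler_pM2r ?powR_gt0//; apply/andP; split; last first.
  exact: sum_powR_signed_norm_le.
have u4 : \sum_s u s ^+ 4 <= 2 ^+ #|I| * (B / 4).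
  have := @sum_powR_signed_norm_le _ 4 _ x y r _ r0 xyr.
  rewrite (eq_bigr (fun s => u s ^+ 4)) => [|s _]; last first.
    by rewrite -[RHS]powR_mulrn.
  by rewrite /B [4 * (_ * _)]mulrC mulfK//; apply.
have u2 : \sum_s u s ^+ 2 = 2 ^+ #|I|.
  under eq_bigr do rewrite expr_div_n.
  by rewrite -mulr_suml -m2 xyr mulrC mulrA mulVf ?mul1r// expf_neq0// gt_eqF.
have uq s : u s ^+ 2 <= 4^-1 + u s ^+ 4 / B + (B * 2 `^ q) * u s `^ q.
  have v1 : 0 <= u s ^+ 4 / B by rewrite divr_ge0 ?exprn_ge0 ?(ltW B0).
  have v2 : 0 <= (B * 2 `^ q) * u s `^ q by rewrite mulr_ge0 ?powR_ge0 ?(ltW B2).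
  have [uB|uB] := leP B (u s ^+ 2).
    suff : u s ^+ 2 <= u s ^+ 4 / B by lra.
    by rewrite ler_pdivlMr// (exprD _ 2 2) ler_wpM2l ?sqr_ge0.
  have [uh|uh] := leP (u s) 2^-1.
    have : u s ^+ 2 <= 2^-1 ^+ 2 by rewrite ler_sqr ?nnegrE.
    by lra.
  suff : B <= (B * 2 `^ q) * u s `^ q by lra.
  rewrite -mulrA ler_peMr ?(ltW B0)// -powRM//.
  rewrite -[leLHS](powRr0 (2 * u s)) ler_powR ?(ltW q0)//; lra.
have : \sum_s u s ^+ 2 <= \sum_s (4^-1 + u s ^+ 4 / B + (B * 2 `^ q) * u s `^ q).
  by apply: ler_sum => s _; exact: uq.
rewrite u2 !big_split/= -mulr_suml -mulr_sumr sumr_const card_ffun card_bool.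
rewrite -[_ *+ (2 ^ _)]mulr_natl natrX => E.
have E4 : (\sum_s u s ^+ 4) / B <= 2 ^+ #|I| / 4.
  rewrite ler_pdivrMr//; apply: le_trans u4 _.
  by rewrite le_eqVlt; apply/orP; left; apply/eqP; ring.
rewrite ler_pdivrMr ?mulr_gt0//; move: E E4.
set P := 2 ^+ _; set Q := \sum_s u s `^ q.
have -> : Q * (2 * (B * 2 `^ q)) = 2 * (B * 2 `^ q * Q) by ring.
by lra.
Qed.

(** * The norm of a Dirichlet polynomial as a mean value *)

Lemma continuous_normr_powR (R : realType) (a : R) : 0 < a ->
  continuous (fun x : R => `|x| `^ a).
Proof.
move=> a0 x; have [->|x0] := eqVneq x 0.
  rewrite /continuous_at normr0 powR0 ?gt_eqF//; apply/cvgrPdist_lt => e e0.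
  have d0 : 0 < e `^ a^-1 by rewrite powR_gt0.
  near=> y.
  rewrite sub0r normrN ger0_norm ?powR_ge0//.
  have yd : `|y| < e `^ a^-1.
    rewrite -[y]subr0 -normrN opprB; near: y.
    by apply: cvgr_dist_lt => //; exact: cvg_id.
  have := gt0_ltr_powR a0 (normr_ge0 _ : `|y| \in Num.nneg)
    (powR_ge0 _ _ : e `^ a^-1 \in Num.nneg) yd.
  by rewrite -powRrM mulVf ?gt_eqF// powRr1 ?ltW.
rewrite /continuous_at /powR normr_eq0 (negbTE x0).
have h : expR (a * ln `|y|) @[y --> (x : R)] --> expR (a * ln `|x|).
  apply: continuous_cvg; first exact: continuous_expR.
  apply: cvgM; first exact: cvg_cst.
  apply: continuous_cvg; last exact: norm_continuous.
  by apply: continuous_ln; rewrite normr_gt0.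
apply: cvg_trans h; apply: near_eq_cvg; near=> y.
suff -> : (`|y| == 0) = false by [].
apply/negbTE; rewrite normr_eq0; near: y.
exact: (@cvgr_neq0 _ _ _ (nbhs x) _ id x cvg_id x0).
Unshelve. all: by end_near. Qed.

Lemma trig_poly_bounded (R : realType) (g : R -> R) : trig_poly g ->
  exists2 M, 0 < M & forall t, `|g t| <= M.
Proof.
elim=> [|c mu th h _ [M M0 hM]]; first by exists 1 => // t; rewrite normr0.
exists (`|c| + M) => [|t]; first by rewrite ltr_wpDl.
apply: le_trans (ler_normD _ _) _; rewrite lerD// normrM ler_piMr//.
by rewrite ler_norml cos_geN1 cos_le1.
Qed.

Definition re_part (R : realType) (lam : nat -> R) (A : {fset nat}) (a : nat -> R[i]) (t : R) : R :=
  \sum_(n <- A) (complex.Re (a n) * cos (lam n * t) + complex.Im (a n) * sin (lam n * t)).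

Definition im_part (R : realType) (lam : nat -> R) (A : {fset nat}) (a : nat -> R[i]) (t : R) : R :=
  \sum_(n <- A) (complex.Im (a n) * cos (lam n * t) - complex.Re (a n) * sin (lam n * t)).

Lemma cexp_imaginary (R : realType) (mu t : R) :
  cexp (- (mu%:C)%C * ('i * (t%:C)%C)) = (cos (mu * t) +i* - sin (mu * t))%C.
Proof.
rewrite -complexiE /cexp; simpc; rewrite /= expR0 cosN sinN; simpc.
by [].
Qed.

Lemma dirichlet_polyE (R : realType) (lam : nat -> R) (A : {fset nat}) (a : nat -> R[i]) (t : R) :
  dirichlet_poly lam A a ('i * (t%:C)%C) = (re_part lam A a t +i* im_part lam A a t)%C.
Proof.
rewrite /dirichlet_poly /re_part /im_part.
elim: (enum_fset A) => [|n s IH]; first by rewrite !big_nil.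
rewrite !big_cons IH cexp_imaginary; case: (a n) => x y /=; simpc.
by rewrite /= [x * sin _]mulrC; congr (_ +i* _)%C; ring.
Qed.

Lemma modulus_dirichlet (R : realType) (lam : nat -> R) (A : {fset nat}) (a : nat -> R[i]) (t : R) :
  modulus (dirichlet_poly lam A a ('i * (t%:C)%C))
    = Num.sqrt (re_part lam A a t ^+ 2 + im_part lam A a t ^+ 2).
Proof. by rewrite dirichlet_polyE. Qed.

Lemma trig_poly_sum (R : realType) (s : seq nat) (g : nat -> R -> R) :
  (forall n, trig_poly (g n)) -> trig_poly (fun t => \sum_(n <- s) g n t).
Proof.
move=> tg; elim: s => [|n s IH].
  by under eq_fun do rewrite big_nil; exact: trig_poly0.
by under eq_fun do rewrite big_cons; exact: trig_polyD.
Qed.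

Lemma trig_poly_cos_sin (R : realType) (c d mu : R) :
  trig_poly (fun t => c * cos (mu * t) + d * sin (mu * t)).
Proof.
have := trig_polyD (trig_poly_cos c mu 0) (trig_poly_cos d mu (- (pi / 2))).
congr trig_poly; apply/funext => t; rewrite addr0 cosB cos_pihalf sin_pihalf.
by rewrite mulr0 add0r mulr1.
Qed.

Lemma trig_poly_modulus_sqr (R : realType) (lam : nat -> R) (A : {fset nat}) (a : nat -> R[i]) :
  trig_poly (fun t => re_part lam A a t ^+ 2 + im_part lam A a t ^+ 2).
Proof.
have tr : trig_poly (re_part lam A a).
  by apply: trig_poly_sum => n; exact: trig_poly_cos_sin.
have ti : trig_poly (im_part lam A a).
  apply: trig_poly_sum => n; under eq_fun do rewrite -mulNr.
  exact: trig_poly_cos_sin.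
by apply: trig_polyD; under eq_fun do rewrite expr2; exact: trig_polyM.
Qed.

(** [|f|^q = (|f|^2)^(q/2)], where [|f|^2] is a bounded trigonometric polynomial;
    it is rescaled into the unit interval in order to apply
    [trig_poly_comp_mean]. *)
Lemma has_mean_modulus_powR (R : realType) (lam : nat -> R) (A : {fset nat})
    (a : nat -> R[i]) (q : R) : 0 < q ->
  has_mean (fun t => modulus (dirichlet_poly lam A a ('i * (t%:C)%C)) `^ q).
Proof.
move=> q0; have tsq := trig_poly_modulus_sqr lam A a.
have [M M0 MP] := trig_poly_bounded tsq.
have q20 : 0 < q / 2 by rewrite divr_gt0.
pose u t := M^-1 * (re_part lam A a t ^+ 2 + im_part lam A a t ^+ 2).
have u0 t : 0 <= u t.
  by rewrite mulr_ge0 ?invr_ge0 ?(ltW M0)// addr_ge0 ?sqr_ge0.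
have tu : trig_poly u by apply: trig_polyM => //; exact: trig_poly_cst.
have u01 t : 0 <= u t <= 1.
  by rewrite u0 /= ler_pdivrMl// mulr1 (le_trans (ler_norm _)).
have := has_meanZ (M `^ (q / 2)) (trig_poly_comp_mean tu u01 (continuous_normr_powR q20)).
congr has_mean; apply/funext => t.
have sq0 : 0 <= re_part lam A a t ^+ 2 + im_part lam A a t ^+ 2.
  by rewrite addr_ge0 ?sqr_ge0.
rewrite ger0_norm// -powRM ?(ltW M0)// /u mulVKf ?gt_eqF// modulus_dirichlet.
by rewrite -powR12_sqrt// -powRrM mulrC.
Qed.

(** The definition takes the [q]-th root inside the limit; the root is
    continuous on the nonnegative reals. *)
Lemma ind_norm_mean (R : realType) (lam : nat -> R) (A : {fset nat})
    (a : nat -> R[i]) (q : R) : 0 < q ->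
  ind_norm q%:E lam a A =
    mean (fun t => modulus (dirichlet_poly lam A a ('i * (t%:C)%C)) `^ q) `^ q^-1.
Proof.
move=> q0; have hm := has_mean_modulus_powR lam A a q0.
set g := (fun t : R => _) in hm *.
have g0 t : 0 <= g t by exact: powR_ge0.
have m0 : 0 <= mean g.
  by have := le_mean (has_mean_cst 0) hm g0; rewrite mean_cst.
(* The absolute values stand in because [powR] is discontinuous at 0 from the left. *)
have h : `|window_mean g T| `^ q^-1 @[T --> +oo] --> `|mean g| `^ q^-1.
  apply: (@continuous_cvg _ _ _ _ _ _ (fun x : R => `|x| `^ q^-1)); last by case: hm.
  by apply: continuous_normr_powR; rewrite invr_gt0.
apply/cvg_lim => //; rewrite -[X in X `^ _](ger0_norm m0).
apply: cvg_trans h; apply: near_eq_cvg; near=> T.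
have T0 : 0 < T by near: T; apply: nbhs_pinfty_gt; exact: num_real.
rewrite ger0_norm// /window_mean mulr_ge0 ?invr_ge0 ?mulr_ge0 ?(ltW T0)//.
by apply: Rintegral_ge0.
Unshelve. all: by end_near. Qed.

(** * Averaging the norms over signs *)

(** Signs on [A] as coefficients indexed by [nat]; the value [1] off [A] keeps
    the coefficients unimodular everywhere. *)
Definition sign_coef (R : realType) (A : {fset nat}) (s : {ffun A -> bool}) (n : nat) : R[i] :=
  if insub n is Some i then (-1) ^+ s i else 1.

Lemma unimodular_sign_coef (R : realType) (A : {fset nat}) (s : {ffun A -> bool}) :
  unimodular A (sign_coef R s).
Proof.
move=> n _; rewrite /sign_coef /modulus; case: (insub n) => [i|];
  last exact: ComplexField.Normc.normc1.
by case: (s i); rewrite ?expr1 ?expr0 ?normcN ComplexField.Normc.normc1.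
Qed.

Lemma sign_coefE (R : realType) (A : {fset nat}) (s : {ffun A -> bool}) (i : A) :
  sign_coef R s (val i) = (((-1) ^+ s i)%:C)%C.
Proof.
rewrite /sign_coef valK; case: (s i); rewrite ?expr0 ?expr1//.
by rewrite rmorphN1.
Qed.

Lemma modulus_signed_dirichlet (R : realType) (lam : nat -> R) (A : {fset nat})
    (s : {ffun A -> bool}) (t : R) :
  modulus (dirichlet_poly lam A (sign_coef R s) ('i * (t%:C)%C)) =
  Num.sqrt (signed_sum (fun i : A => cos (lam (val i) * t)) s ^+ 2 +
            signed_sum (fun i : A => - sin (lam (val i) * t)) s ^+ 2).
Proof.
rewrite modulus_dirichlet /re_part /im_part /signed_sum !big_seq_fsetE/=.
congr (Num.sqrt (_ ^+ 2 + _ ^+ 2)); apply: eq_bigr => i _; rewrite sign_coefE/=.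
  by rewrite mul0r addr0.
by rewrite mul0r add0r mulrN.
Qed.

(** For fixed [t] the sum over signs of [|f(t)|^q] is estimated by [khinchine],
    with [r^2 = #|A|] because the exponentials are unimodular; the mean over [t]
    is linear and monotone. *)
Lemma khinchine_dirichlet (R : realType) (q : R) : 0 < q ->
  exists k K : R, [/\ 0 < k, 0 < K &
    forall (lam : nat -> R) (A : {fset nat}),
      2 ^+ #|{: A}| * (k * Num.sqrt #|` A|%:R) `^ q
        <= \sum_(s : {ffun A -> bool}) ind_norm q%:E lam (sign_coef R s) A `^ q
        <= 2 ^+ #|{: A}| * (K * Num.sqrt #|` A|%:R) `^ q].
Proof.
move=> q0; have [k [K [k0 K0 kK]]] := khinchine q0.
exists (k `^ q^-1), (K `^ q^-1); split; [exact: powR_gt0|exact: powR_gt0|].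
move=> lam A; set r := Num.sqrt _; have r0 : 0 <= r by exact: sqrtr_ge0.
have qV (x : R) : 0 <= x -> (x `^ q^-1) `^ q = x.
  by move=> x0; rewrite -powRrM mulVf ?gt_eqF// powRr1.
rewrite !powRM ?powR_ge0// !qV ?(ltW k0) ?(ltW K0)//.
pose f (s : {ffun A -> bool}) t :=
  modulus (dirichlet_poly lam A (sign_coef R s) ('i * (t%:C)%C)) `^ q.
have hf s : has_mean (f s) by exact: has_mean_modulus_powR.
have -> : \sum_(s : {ffun A -> bool}) ind_norm q%:E lam (sign_coef R s) A `^ q
    = mean (fun t => \sum_s f s t).
  rewrite (mean_sum hf); apply: eq_bigr => s _; rewrite ind_norm_mean// qV//.
  have := le_mean (has_mean_cst 0) (hf s) (fun t => powR_ge0 _ _).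
  by rewrite mean_cst.
have H t : 2 ^+ #|{: A}| * (k * r `^ q) <= \sum_s f s t <= 2 ^+ #|{: A}| * (K * r `^ q).
  rewrite /f; under eq_bigr do rewrite modulus_signed_dirichlet.
  apply: kK => //; rewrite /r sqr_sqrtr// (eq_bigr (fun=> 1)) => [|i _].
    by rewrite sumr_const cardfE.
  by rewrite sqrrN cos2Dsin2.
have hs := has_mean_sum hf.
rewrite -[X in X <= _ <= _]mean_cst -[X in _ <= _ <= X]mean_cst.
apply/andP; split.
  by apply: le_mean (has_mean_cst _) hs _ => t; have /andP[] := H t.
by apply: le_mean hs (has_mean_cst _) _ => t; have /andP[] := H t.
Qed.

Lemma ind_norm_ge0 (R : realType) (q : R) lam (A : {fset nat}) (a : nat -> R[i]) : 0 < q ->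
  0 <= ind_norm q%:E lam a A.
Proof. by move=> q0; rewrite ind_norm_mean// powR_ge0. Qed.

Definition ind_norm_bounds (R : realType) (p : \bar R) (lam g : nat -> R) (c C : R) : Prop :=
  forall (A : {fset nat}) (eps : nat -> R[i]), unimodular A eps ->
    c * g #|` A| <= ind_norm p lam eps A <= C * g #|` A|.

(** Under SUCC a given norm is comparable with each of those for signs, hence
    with their average. *)
Lemma succ_ind_norm_bounds (R : realType) (lam : nat -> R) (q : R) : 0 < q ->
  SUCC q%:E lam ->
  exists c C : R, [/\ 0 < c, 0 < C &
    ind_norm_bounds q%:E lam (fun N => Num.sqrt N%:R) c C].
Proof.
move=> q0 [D D0 HD]; have [k [K [k0 K0 kK]]] := khinchine_dirichlet q0.
exists (k / D), (D * K); split; [exact: divr_gt0|exact: mulr_gt0|move=> A eps ue].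
have /andP[kA KA] := kK lam A.
have us := @unimodular_sign_coef R A.
have n0 a := ind_norm_ge0 lam A a q0.
have P0 : 0 < 2 ^+ #|{: A}| :> R by rewrite exprn_gt0.
have powq (x y : R) : 0 <= x -> 0 <= y -> x `^ q <= y `^ q -> x <= y.
  move=> x0 y0; apply: contraTT; rewrite -!ltNge => xy.
  by apply: gt0_ltr_powR.
have cst (x : R) : \sum_(s : {ffun A -> bool}) x = 2 ^+ #|{: A}| * x.
  by rewrite sumr_const card_ffun card_bool -[LHS]mulr_natl natrX.
apply/andP; split.
  rewrite mulrAC ler_pdivrMr//; apply: powq; rewrite ?mulr_ge0 ?sqrtr_ge0 ?(ltW k0) ?(ltW D0)//.
  rewrite -(ler_pM2l P0); apply: le_trans kA _; rewrite -cst; apply: ler_sum => s _.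
  apply: ge0_ler_powR; rewrite ?nnegrE ?(ltW q0) ?mulr_ge0 ?(ltW D0)//.
  by rewrite mulrC; exact: HD.
rewrite -mulrA -ler_pdivrMl//; apply: powq;
  rewrite ?mulr_ge0 ?sqrtr_ge0 ?invr_ge0 ?(ltW K0) ?(ltW D0)//.
rewrite -(ler_pM2l P0); apply: le_trans KA; rewrite -cst; apply: ler_sum => s _.
apply: ge0_ler_powR; rewrite ?nnegrE ?(ltW q0) ?mulr_ge0 ?invr_ge0 ?(ltW D0)//.
by rewrite ler_pdivrMl//; exact: HD.
Qed.

(** * The supremum norm *)

Lemma unimodular1 (R : realType) (A : {fset nat}) : unimodular A (fun=> 1 : R[i]).
Proof. by move=> n _; exact: ComplexField.Normc.normc1. Qed.

Lemma modulus_dirichlet_le (R : realType) (lam : nat -> R) (A : {fset nat}) (eps : nat -> R[i]) :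
  unimodular A eps ->
  forall t, modulus (dirichlet_poly lam A eps ('i * (t%:C)%C)) <= #|` A|%:R.
Proof.
move=> ue t; rewrite /dirichlet_poly.
have : {subset enum_fset A <= A} by [].
elim: (enum_fset A) => [|n s IH] sA.
  by rewrite big_nil /modulus ComplexField.Normc.normc0.
rewrite big_cons /modulus; apply: le_trans (le_normcD _ _) _.
rewrite /= -nat1r lerD//; last by apply: IH => i si; apply: sA; rewrite inE si orbT.
rewrite ComplexField.Normc.normcM (_ : ComplexField.Normc.normc (eps n) = 1); last first.
  by apply: ue; apply: sA; rewrite mem_head.
by rewrite mul1r cexp_imaginary /= sqrrN cos2Dsin2 sqrtr1.
Qed.

Lemma ind_norm_pinfty_le (R : realType) (lam : nat -> R) (A : {fset nat}) (eps : nat -> R[i]) :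
  unimodular A eps -> ind_norm +oo%E lam eps A <= #|` A|%:R.
Proof.
move=> ue; apply: ge_sup => [|_ [t _ <-]]; last exact: modulus_dirichlet_le.
by exists (modulus (dirichlet_poly lam A eps ('i * (0%:C)%C))), 0.
Qed.

(** At [t = 0] all the exponentials are [1], so the triangle inequality is an
    equality. *)
Lemma ind_norm_pinfty1 (R : realType) (lam : nat -> R) (A : {fset nat}) :
  ind_norm +oo%E lam (fun=> 1) A = #|` A|%:R.
Proof.
apply/eqP; rewrite eq_le (ind_norm_pinfty_le lam (@unimodular1 R A))/=; apply: ub_le_sup.
  by exists #|` A|%:R => _ [t _ <-]; apply: modulus_dirichlet_le; exact: unimodular1.
exists 0 => //; rewrite modulus_dirichlet /re_part /im_part.
rewrite (eq_bigr (fun=> 1)) => [|n _]; last by rewrite !mulr0 cos0 mul0r addr0 mul1r.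
rewrite [X in _ + X ^+ 2]big1 => [|n _]; last by rewrite !mulr0 sin0 mul0r mulr0 subr0.
by rewrite expr0n addr0 sqrtr_sqr big_seq_fsetE/= sumr_const -cardfE ger0_norm.
Qed.

(** * From two-sided bounds to democracy *)

Lemma super_democratic_succ (R : realType) (p : \bar R) (lam : nat -> R) :
  super_democratic p lam -> SUCC p lam.
Proof.
move=> [C C0 HC]; exists C => // A B eps eps' AB; apply: HC.
exact: fsubset_leq_card.
Qed.

Lemma exists_fset_card (N : nat) : exists A : {fset nat}, #|` A| = N.
Proof.
by exists [fset x in iota 0 N]%fset; rewrite card_fseq undup_id ?iota_uniq// size_iota.
Qed.

Lemma bounds_super_democratic (R : realType) (p : \bar R) (lam g : nat -> R) (c C : R) :
  0 < c -> 0 < C -> {homo g : m n / (m <= n)%N >-> m <= n} ->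
  ind_norm_bounds p lam g c C ->
  super_democratic p lam.
Proof.
move=> c0 C0 g_mono bounds.
exists (C / c); first exact: divr_gt0.
move=> A B eps eps' AB uA uB.
have /andP[_ hA] := bounds _ _ uA; have /andP[hB _] := bounds _ _ uB.
apply: le_trans hA _; rewrite -mulrA ler_wpM2l ?(ltW C0)// ler_pdivlMl//.
by apply: le_trans hB; rewrite ler_wpM2l ?(ltW c0)// g_mono.
Qed.

Lemma bounds_phi_l (R : realType) (p : \bar R) (lam g : nat -> R) (c C : R) (N : nat) :
  0 < c -> {homo g : m n / (m <= n)%N >-> m <= n} ->
  ind_norm_bounds p lam g c C ->
  c * g N <= phi_l p lam N <= C * g N.
Proof.
move=> c0 g_mono bounds.
have lb : lbound [set x | exists (A : {fset nat}) (eps : nat -> R[i]),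
    [/\ (N <= #|` A|)%N, unimodular A eps & x = ind_norm p lam eps A]] (c * g N).
  move=> _ [A [eps [NA ue ->]]]; have /andP[h _] := bounds _ _ ue.
  by apply: le_trans h; rewrite ler_wpM2l ?(ltW c0)// g_mono.
have [A NA] := exists_fset_card N; have /andP[_ h] := bounds _ _ (@unimodular1 R A).
have w : [set x | exists (A : {fset nat}) (eps : nat -> R[i]),
    [/\ (N <= #|` A|)%N, unimodular A eps & x = ind_norm p lam eps A]]
    (ind_norm p lam (fun=> 1) A).
  by exists A, (fun=> 1); split => //; [rewrite NA|exact: unimodular1].
apply/andP; split; first by apply: lb_le_inf => //; eexists; exact: w.
by rewrite NA in h; apply: le_trans h; apply: ge_inf => //; exists (c * g N).
Qed.

Lemma bounds_phi_u (R : realType) (p : \bar R) (lam g : nat -> R) (c C : R) (N : nat) :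
  0 < C -> {homo g : m n / (m <= n)%N >-> m <= n} ->
  ind_norm_bounds p lam g c C ->
  c * g N <= phi_u p lam N <= C * g N.
Proof.
move=> C0 g_mono bounds.
have ub : ubound [set x | exists (A : {fset nat}) (eps : nat -> R[i]),
    [/\ (#|` A| <= N)%N, unimodular A eps & x = ind_norm p lam eps A]] (C * g N).
  move=> _ [A [eps [NA ue ->]]]; have /andP[_ h] := bounds _ _ ue.
  by apply: le_trans h _; rewrite ler_wpM2l ?(ltW C0)// g_mono.
have [A NA] := exists_fset_card N; have /andP[h _] := bounds _ _ (@unimodular1 R A).
have w : [set x | exists (A : {fset nat}) (eps : nat -> R[i]),
    [/\ (#|` A| <= N)%N, unimodular A eps & x = ind_norm p lam eps A]]
    (ind_norm p lam (fun=> 1) A).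
  by exists A, (fun=> 1); split => //; [rewrite NA|exact: unimodular1].
apply/andP; split; last by apply: ge_sup => //; eexists; exact: w.
by rewrite NA in h; apply: le_trans h _; apply: ub_le_sup => //; exists (C * g N).
Qed.

Theorem theorem4p3 (R : realType) (lam : nat -> R) (p : \bar R) :
  frequency lam -> (1 <= p)%E ->
  (SUCC p lam <-> super_democratic p lam) /\
  (SUCC p lam ->
     ((p < +oo)%E ->
        approx (phi_l p lam) (fun N : nat => Num.sqrt (N%:R : R)) /\
        approx (fun N : nat => Num.sqrt (N%:R : R)) (phi_u p lam)) /\
     (p = +oo%E ->
        approx (phi_l p lam) (fun N : nat => N%:R : R) /\
        forall N : nat, (0 < N)%N -> N%:R = phi_u p lam N)).
Proof.
move=> _; case: p => [q| |//] p1.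
- have q0 : 0 < q by rewrite lee_fin in p1; exact: lt_le_trans p1.
  have g_mono m n : (m <= n)%N -> Num.sqrt (m%:R : R) <= Num.sqrt n%:R.
    by move=> mn; rewrite ler_wsqrtr// ler_nat.
  split; first split; [|exact: super_democratic_succ|].
    move=> /(succ_ind_norm_bounds q0)[c [C [c0 C0 cC]]].
    exact: (bounds_super_democratic c0 C0 g_mono cC).
  move=> /(succ_ind_norm_bounds q0)[c [C [c0 C0 cC]]]; split => [_|//]; split.
    exists c, C; split => // N _; apply/andP.
    exact: (bounds_phi_l _ c0 g_mono cC).
  exists C^-1, c^-1; split; rewrite ?invr_gt0// => N _; apply/andP.
  rewrite ler_pdivrMl// ler_pdivlMl// andbC.
  exact: (bounds_phi_u _ C0 g_mono cC).
- have g_mono m n : (m <= n)%N -> m%:R <= n%:R :> R by rewrite ler_nat.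
  have bounds : SUCC +oo%E lam -> exists2 c : R, 0 < c &
      ind_norm_bounds +oo%E lam (fun N => N%:R) c 1.
    move=> [D D0 HD]; exists D^-1; first by rewrite invr_gt0.
    move=> A eps ue; rewrite mul1r ind_norm_pinfty_le// andbT ler_pdivrMl//.
    by rewrite -(ind_norm_pinfty1 lam A); apply: HD => //; exact: unimodular1.
  split; first split; [|exact: super_democratic_succ|].
    move=> /bounds[c c0 cC].
    exact: (bounds_super_democratic c0 ltr01 g_mono cC).
  move=> /bounds[c c0 cC]; split => // _; split.
    exists c, 1; split => // N _; apply/andP.
    exact: (bounds_phi_l _ c0 g_mono cC).
  move=> N _; apply/eqP; rewrite eq_le; apply/andP; split.
    have [A NA] := exists_fset_card N; rewrite -NA -(ind_norm_pinfty1 lam A).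
    apply: ub_le_sup; last by exists A, (fun=> 1); split; [|exact: unimodular1|].
    exists #|` A|%:R => _ [B [eps [BA ue ->]]].
    by apply: le_trans (ind_norm_pinfty_le lam ue) _; rewrite ler_nat.
  by have /andP[_] := bounds_phi_u N ltr01 g_mono cC; rewrite mul1r.
Qed.
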